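(* Let $A\in\mathbb{R}^{n\times n}$, $B_1,B_2\in\mathbb{R}^{n\times 1}$, $C_1\in\mathbb{R}^{1\times n}$, and consider the system with scalar signals $w,u,z$ $$\dot x = Ax + B_1 w + B_2 u,\qquad z = C_1 x .$$ Suppose that $C_1B_2$ is nonsingular (i.e. nonzero) and that $R = C_1B_1 + B_1^TC_1^T>0$. Put $Q = I - B_2(C_1B_2)^{-1}C_1$ and $A_q = QA$, and suppose that $A_q$ has no unstable eigenvalues. Let $\epsilon>0$ be such that $A_r = Q(A+\epsilon I)$ also has no unstable eigenvalues. Then there exists a static state feedback matrix $K\in\mathbb{R}^{1\times n}$ such that, under $u=Kx$, the closed-loop system $$\dot x = (A+B_2K)x + B_1 w,\qquad z = C_1x$$ is strictly negative imaginary with degree of stability $\epsilon$. The required state feedback matrix is given by $$K = -(C_1B_2)^{-1}(C_1A+\epsilon C_1).$$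
   Context: An eigenvalue $\lambda$ is called unstable if $\operatorname{Re}\lambda>0$; ''no unstable eigenvalues'' means that all eigenvalues lie in the closed left half-plane $\{\operatorname{Re}\lambda\le 0\}$. A square transfer function matrix $G(s)$ is strictly negative imaginary (SNI) if (1) $G(s)$ has no poles in $\operatorname{Re}[s]\ge 0$ and (2) $j\,(G(j\omega)-G(j\omega)^* )>0$ for all $\omega>0$, where $j=\sqrt{-1}$ and $^*$ is the conjugate transpose. A state space system is SNI if its transfer function matrix is; for the closed-loop system above this is $G_{cl}(s)=C_1(sI-A-B_2K)^{-1}B_1$. The closed-loop system is SNI with degree of stability $\epsilon$ if it is SNI and every eigenvalue $\lambda$ of $A+B_2K$ satisfies $\operatorname{Re}\lambda\le-\epsilon$. *)

(* Defs.v *)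
From HB Require Import structures.
From mathcomp Require Import all_boot all_order all_algebra.
From mathcomp Require Import fraction generic_quotient.
From mathcomp Require Import complex.
From mathcomp Require Import reals.

Set Implicit Arguments.
Unset Strict Implicit.
Unset Printing Implicit Defensive.

Import Order.TTheory GRing.Theory Num.Theory.
Local Open Scope ring_scope.
Local Open Scope complex_scope.

(* [repr g] is an arbitrary representative, so its numerator and denominator  *)
(* may share factors; dividing by their gcd gives g in lowest terms.          *)
Definition reduced_numer (F : fieldType) (g : {fraction {poly F}}) : {poly F} :=
  let r := repr g in \n_r %/ gcdp \n_r \d_r.

Definition reduced_denom (F : fieldType) (g : {fraction {poly F}}) : {poly F} :=
  let r := repr g in \d_r %/ gcdp \n_r \d_r.

(* A pole of a rational matrix is a pole of one of its entries, that is, a    *)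
(* zero of the denominator left after cancelling all common factors.          *)
Definition is_pole (F : fieldType) m p (G : 'M[{fraction {poly F}}]_(m, p))
    (s : F) : Prop :=
  exists i j, root (reduced_denom (G i j)) s.

(* The value G(s); it is meaningful only when s is not a pole of G.           *)
Definition tf_eval (F : fieldType) m p (G : 'M[{fraction {poly F}}]_(m, p))
    (s : F) : 'M[F]_(m, p) :=
  \matrix_(i, j) ((reduced_numer (G i j)).[s] / (reduced_denom (G i j)).[s]).

(* C (s I - A)^-1 B as a matrix of rational functions of s; [char_poly_mx A]  *)
(* is 'X%:M - A, always invertible over the field of fractions.               *)
Definition transfer_function (R : rcfType) n m p
    (A : 'M[R]_n) (B : 'M[R]_(n, m)) (C : 'M[R]_(p, n)) :
    'M[{fraction {poly R[i]}}]_(p, m) :=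
  let toF (x : R) : {fraction {poly R[i]}} := tofrac (x%:C)%:P in
  map_mx toF C
  *m invmx (map_mx (@tofrac _) (char_poly_mx (map_mx (real_complex R) A)))
  *m map_mx toF B.

Definition adjointmx (R : rcfType) m p (M : 'M[R[i]]_(m, p)) : 'M[R[i]]_(p, m) :=
  map_mx (@conjc R) M^T.

(* In the order of R[i], 0 < z means that z is real and positive, so the      *)
(* condition also forces M to be Hermitian.                                   *)
Definition posdefmx (R : rcfType) m (M : 'M[R[i]]_m) : Prop :=
  forall x : 'cV[R[i]]_m, x != 0 -> 0 < (adjointmx x *m M *m x) 0 0.

Definition strictly_negative_imaginary (R : rcfType) m
    (G : 'M[{fraction {poly R[i]}}]_m) : Prop :=
  (forall s : R[i], 0 <= complex.Re s -> ~ is_pole G s) /\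
  (forall w : R, 0 < w ->
     let Gjw := tf_eval G ('i%C * w%:C) in
     posdefmx ('i%C *: (Gjw - adjointmx Gjw))).

(* The eigenvalues of a real matrix are those of its complexification.        *)
Definition eigenvalue_of (R : rcfType) n (A : 'M[R]_n) (l : R[i]) : bool :=
  eigenvalue (map_mx (real_complex R) A) l.

Definition no_unstable_eigenvalues (R : rcfType) n (A : 'M[R]_n) : Prop :=
  forall l : R[i], eigenvalue_of A l -> complex.Re l <= 0.

Definition sni_with_degree_of_stability (R : rcfType) n m (eps : R)
    (A : 'M[R]_n) (B : 'M[R]_(n, m)) (C : 'M[R]_(m, n)) : Prop :=
  strictly_negative_imaginary (transfer_function A B C) /\
  (forall l : R[i], eigenvalue_of A l -> complex.Re l <= - eps).

(* Main.v *)
(** The feedback makes the closed-loop matrix equal to [Q (A + eps I) - eps I],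
    which places its spectrum to the left of [- eps].  Since [C1 Q = 0], the row
    [C1] is then a left eigenvector for the eigenvalue [- eps], so every other
    mode is unobservable from [z] and the transfer function collapses to
    [C1 B1 / (s + eps)] with [C1 B1 > 0]. *)

Require Import Defs.
From HB Require Import structures.
From mathcomp Require Import all_boot all_order all_algebra.
From mathcomp Require Import fraction generic_quotient.
From mathcomp Require Import ring.
From mathcomp Require Import complex reals.

Set Implicit Arguments.
Unset Strict Implicit.
Unset Printing Implicit Defensive.

Import Order.TTheory GRing.Theory Num.Theory.
Local Open Scope ring_scope.

Section ReducedFraction.
Variable F : fieldType.
Implicit Types (g : {fraction {poly F}}) (p q : {poly F}).

(** Equality of fractions is equality of classes of [ratio], hence cross-multiplication of any two
    representatives; those of [tofrac] have denominator 1. *)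
Lemma numer_denom_repr g p q : g * tofrac q = tofrac p ->
  \n_(repr g) * q = p * \d_(repr g).
Proof.
rewrite -{1}[g]reprK; unlock tofrac; rewrite -[LHS]FracField.pi_mul.
move=> /eqmodP /eqP /=.
rewrite !numden_Ratio ?mulf_neq0 ?denom_ratioP ?oner_neq0 // !mulr1 => ->.
by rewrite mulrC.
Qed.

Lemma gcdp_numer_denom_neq0 g : gcdp \n_(repr g) \d_(repr g) != 0.
Proof. by rewrite gcdp_eq0 (negPf (denom_ratioP _)) andbF. Qed.

Lemma coprimep_reduced g : coprimep (reduced_numer g) (reduced_denom g).
Proof. by rewrite coprimep_div_gcd // orbC denom_ratioP. Qed.

Lemma reduced_fractionE g p q : g * tofrac q = tofrac p ->
  reduced_numer g * q = p * reduced_denom g.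
Proof.
move=> /numer_denom_repr E; apply: (mulIf (gcdp_numer_denom_neq0 g)).
by rewrite mulrAC -[RHS]mulrA !divpK ?dvdp_gcdl ?dvdp_gcdr.
Qed.

(** Gauss's lemma: the reduced denominator divides the reduced numerator times [q] and is coprime to
    the former. So any denominator of [g], in lowest terms or not, bounds its poles. *)
Lemma reduced_denom_dvd g p q : g * tofrac q = tofrac p -> reduced_denom g %| q.
Proof.
move=> /reduced_fractionE E; have cop : coprimep (reduced_denom g) (reduced_numer g).
  by rewrite coprimep_sym coprimep_reduced.
by rewrite -(Gauss_dvdpr _ cop) E dvdp_mulIr.
Qed.

Lemma root_reduced_denom g p q s : g * tofrac q = tofrac p ->
  root (reduced_denom g) s -> root q s.
Proof. by move=> /reduced_denom_dvd dq; rewrite !root_factor_theorem => /dvdp_trans; apply. Qed.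

Lemma reduced_fraction_horner g p q s : g * tofrac q = tofrac p -> q.[s] != 0 ->
  (reduced_numer g).[s] / (reduced_denom g).[s] = p.[s] / q.[s].
Proof.
move=> E qs; have ds : (reduced_denom g).[s] != 0.
  by apply: contra qs; exact: root_reduced_denom E.
by apply/eqP; rewrite eqr_div // -!hornerM (reduced_fractionE E).
Qed.

End ReducedFraction.

(** From [C (sI - A) = (s - a) C], multiplying by the inverse on the right gives
    [(s - a) C (sI - A)^-1 = C]. The product form feeds the lemmas on reduced fractions directly. *)
Lemma transfer_function_left_eigenvector (R : rcfType) n m p
    (A : 'M[R]_n) (B : 'M[R]_(n, m)) (C : 'M[R]_(p, n)) (a : R) i j :
  C *m A = a *: C ->
  transfer_function A B C i j * tofrac ('X - (real_complex R a)%:P)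
  = tofrac (real_complex R ((C *m B) i j))%:P.
Proof.
move=> CA; rewrite /transfer_function.
set toF := fun x : R => tofrac (real_complex R x)%:P.
set M := map_mx _ (char_poly_mx _); set q := tofrac _.
(* Factoring the embedding through polynomials over [R[i]] lets the identities be checked on
   polynomial matrices. *)
have toFE k l (X : 'M[R]_(k, l)) :
    map_mx toF X = map_mx (@tofrac _) (map_mx polyC (map_mx (real_complex R) X)).
  by rewrite -!map_mx_comp.
have CM : map_mx toF C *m M = q *: map_mx toF C.
  rewrite !toFE -map_mxM -map_mxZ; congr (map_mx _ _).
  rewrite /char_poly_mx mulmxBr mul_mx_scalar -!map_mxM CA !map_mxZ /=.
  by rewrite scalerBl.
have Mu : M \in unitmx.
  by rewrite unitmxE det_map_mx unitfE tofrac_eq0 monic_neq0 // char_poly_monic.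
have CMi : q *: (map_mx toF C *m invmx M) = map_mx toF C.
  by rewrite scalemxAl -CM mulmxK.
transitivity ((q *: (map_mx toF C *m invmx M *m map_mx toF B)) i j).
  by rewrite [RHS]mxE [LHS]mulrC.
rewrite scalemxAl CMi !toFE -!map_mxM.
by rewrite !mxE.
Qed.

Lemma posdefmx11 (R : rcfType) (M : 'M[R[i]]_1) : 0 < M 0 0 -> posdefmx M.
Proof.
move=> M0 x x0; rewrite /adjointmx !mxE big_ord1 !mxE big_ord1 !mxE.
have {}x0 : x 0 0 != 0.
  by apply: contra x0 => /eqP x0; apply/eqP/matrixP => i j; rewrite !ord1 mxE.
by rewrite mulrAC pmulr_lgt0 // mulrC mul_conjC_gt0.
Qed.

Lemma sni_first_order_lag (R : rcfType) (G : 'M[{fraction {poly R[i]}}]_1)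
    (c a : R) : 0 < c -> 0 < a ->
  G 0 0 * tofrac ('X + (real_complex R a)%:P) = tofrac (real_complex R c)%:P ->
  strictly_negative_imaginary G.
Proof.
move=> c0 a0 E; split=> [s s0 [i [j]]|w w0 /=].
  rewrite !ord1 => /(root_reduced_denom E).
  rewrite rootE !hornerE addr_eq0 => /eqP sE.
  by move: s0; rewrite sE /= leNgt oppr_lt0 a0.
apply: posdefmx11; rewrite !mxE.
set s := 'i%C * real_complex R w.
have sE : s + real_complex R a = Complex a w.
  by apply/eqP; rewrite eq_complex /=; apply/andP; split; apply/eqP; ring.
have sa0 : ('X + (real_complex R a)%:P).[s] != 0.
  by rewrite !hornerE sE eq_complex /= gt_eqF.
(* Since [z - conj z = 2 j Im z], the outer factor [j] turns the goal into [Im G(jw) < 0]. *)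
rewrite (reduced_fraction_horner E sa0) !hornerE sE subcJ.
rewrite mulrCA -expr2 sqr_i mulrN1 oppr_gt0 pmulr_rlt0 ?ltr0n // ltcR /=.
rewrite mul0r addr0 mulrN oppr_lt0 mulr_gt0 // divr_gt0 //.
by rewrite addr_gt0 // exprn_gt0.
Qed.

Lemma eigenvalue_of_subr_scalar (R : rcfType) n (A : 'M[R]_n) (a : R) l :
  eigenvalue_of (A - a%:M) l -> eigenvalue_of A (l + real_complex R a).
Proof.
rewrite /eigenvalue_of => /eigenvalueP[v vA v0]; apply/eigenvalueP; exists v => //.
move: vA; rewrite map_mxB map_scalar_mx mulmxBr mul_mx_scalar => /eqP.
by rewrite subr_eq -scalerDl => /eqP.
Qed.

Theorem theorem6 (R : realType) (n : nat)
    (A : 'M[R]_n) (B1 B2 : 'M[R]_(n, 1)) (C1 : 'M[R]_(1, n)) (eps : R) :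
  C1 *m B2 \in unitmx ->
  0 < (C1 *m B1 + B1^T *m C1^T) 0 0 ->
  let Q := 1%:M - B2 *m invmx (C1 *m B2) *m C1 in
  no_unstable_eigenvalues (Q *m A) ->
  0 < eps ->
  no_unstable_eigenvalues (Q *m (A + eps%:M)) ->
  exists K : 'M[R]_(1, n),
    K = - (invmx (C1 *m B2) *m (C1 *m A + eps *: C1)) /\
    sni_with_degree_of_stability eps (A + B2 *m K) B1 C1.
Proof.
move=> CBu CB1 Q _ eps0 Aru; eexists; split; first reflexivity.
set K := - _.
(* Writing [eps *: C1] as [C1 *m eps%:M] gives [B2 K = (Q - I)(A + eps I)]. *)
have AclE : A + B2 *m K = Q *m (A + eps%:M) - eps%:M.
  rewrite /Q /K mulmxBl mul1mx mulmxN -mul_mx_scalar -mulmxDr !mulmxA.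
  by rewrite addrAC addrK.
have CQ : C1 *m Q = 0.
  by rewrite /Q mulmxBr mulmx1 !mulmxA mulmxV // mul1mx subrr.
have CAcl : C1 *m (A + B2 *m K) = (- eps) *: C1.
  by rewrite AclE mulmxBr mulmxA CQ mul0mx sub0r mul_mx_scalar scaleNr.
split=> [|l].
  apply: (@sni_first_order_lag _ _ ((C1 *m B1) 0 0) eps) => //.
    (* A 1 by 1 matrix equals its transpose, so the positive quantity is twice [C1 B1]. *)
    by move: CB1; rewrite -trmx_mul mxE [X in _ + X]mxE -mulr2n pmulrn_lgt0.
  by rewrite -(transfer_function_left_eigenvector _ _ _ CAcl) rmorphN polyCN opprK.
(* Undoing the shift, [l + eps] is an eigenvalue of [Q (A + eps I)], so [Re l + eps <= 0]. *)
rewrite AclE => /eigenvalue_of_subr_scalar /Aru.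
by rewrite raddfD /= -lerBrDr sub0r.
Qed.
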